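(* Let $G$ be a finite group, with cardinality $|G|$, acting linearly and isometrically on $\mathbb{R}^n$. Let $X\sim\mathcal{N}(t_0,s^2\,\mathrm{Id}_{\mathbb{R}^n})$ with $s>0$ and let $m_\star$ be a global minimiser of $F$. Then $$d_Q([t_0],[m_\star])\le s\sqrt{8\log|G|}.$$
   Context: The action is linear and isometric: each $x\mapsto g\cdot x$ is linear with $\|g\cdot x\|=\|x\|$ (Euclidean norm). $[m]=\{g\cdot m:g\in G\}$, $d_Q([a],[b])=\min_{g\in G}\|g\cdot a-b\|$, and $F(m)=\mathbb{E}\big(\min_{g\in G}\|g\cdot X-m\|^2\big)$. *)

(* Defs.v *)
From HB Require Import structures.
From mathcomp Require Import all_boot all_order all_algebra all_fingroup.
From mathcomp Require Import all_classical all_reals all_analysis.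
Set Implicit Arguments. Unset Strict Implicit. Unset Printing Implicit Defensive.
Import Order.TTheory GRing.Theory Num.Theory.
Local Open Scope classical_set_scope.
Local Open Scope ring_scope.

Definition enorm (R : realType) (n : nat) (x : 'rV[R]_n) : R :=
  Num.sqrt (\sum_(i < n) x ord0 i ^+ 2).

Definition lin_iso_action (R : realType) (n : nat) (gT : finGroupType)
  (act : gT -> 'rV[R]_n -> 'rV[R]_n) : Prop :=
  [/\ (forall x, act 1%g x = x),
      (forall g h x, act (g * h)%g x = act g (act h x)),
      (forall g (a : R) x y, act g (a *: x + y) = a *: act g x + act g y) &
      (forall g x, enorm (act g x) = enorm x)].

(* min_{g in G} ||g.a - b||  (the big min is seeded with the value at g = 1,
   which is itself one of the terms, so this is the exact minimum). *)
Definition orbit_dist (R : realType) (n : nat) (gT : finGroupType)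
  (act : gT -> 'rV[R]_n -> 'rV[R]_n) (a b : 'rV[R]_n) : R :=
  \big[Num.min/enorm (act 1%g a - b)]_(g : gT) enorm (act g a - b).

Definition dQ (R : realType) (n : nat) (gT : finGroupType)
  (act : gT -> 'rV[R]_n -> 'rV[R]_n) (a b : 'rV[R]_n) : R :=
  orbit_dist act a b.

Definition rvec d (T : measurableType d) (R : realType) (P : probability T R)
  (n : nat) (X : 'I_n -> {RV P >-> R}) (w : T) : 'rV[R]_n :=
  \row_(i < n) X i w.

Definition mutually_independent d (T : measurableType d) (R : realType)
  (P : probability T R) (n : nat) (X : 'I_n -> {RV P >-> R}) : Prop :=
  forall B : 'I_n -> set R, (forall i, measurable (B i)) ->
    P (\bigcap_(i in [set: 'I_n]) (X i @^-1` B i)) =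
    (\prod_(i < n) P (X i @^-1` B i))%E.

Definition is_gaussian_vector d (T : measurableType d) (R : realType)
  (P : probability T R) (n : nat) (X : 'I_n -> {RV P >-> R})
  (t0 : 'rV[R]_n) (s : R) : Prop :=
  mutually_independent X /\
  forall i (A : set R), measurable A ->
    distribution P (X i) A = normal_prob (t0 ord0 i) s A.

Definition Frechet_F d (T : measurableType d) (R : realType)
  (P : probability T R) (n : nat) (gT : finGroupType)
  (act : gT -> 'rV[R]_n -> 'rV[R]_n) (X : 'I_n -> {RV P >-> R})
  (m : 'rV[R]_n) : \bar R :=
  'E_P[fun w => orbit_dist act (rvec X w) m ^+ 2].

(* Main.v *)
Require Import Defs.
From HB Require Import structures.
From mathcomp Require Import all_boot all_order all_algebra all_fingroup.
From mathcomp Require Import all_classical all_reals all_analysis.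
From mathcomp Require Import measurable_realfun.
From mathcomp Require Import ring lra.
Import Order.TTheory GRing.Theory Num.Theory.
Import HBNNSimple.
Local Open Scope classical_set_scope.
Local Open Scope ring_scope.

Set Implicit Arguments.
Unset Strict Implicit.
Unset Printing Implicit Defensive.

(* Write S = |X - t0|^2, D = min_g |g.X - m|^2 and b = 1 / (4 s^2). If the
   closest orbit point is reached at g, then 1 + x <= exp x at
   x = b (S - D) gives the pointwise bound
     1 + b S <= b D + sum_g exp (b (S - |X - g^-1.m|^2)).
   Minimality of m yields E D <= F(t0) <= E S < +oo, so b E S cancels after
   taking expectations. The exponents are affine in X, and the Gaussian moment
   generating function evaluates the remaining terms:
     1 <= sum_g exp (- |t0 - g^-1.m|^2 / (8 s^2))
       <= |G| exp (- dQ(t0, m)^2 / (8 s^2)).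
   The value of b is the one that optimizes the constant. *)

(** * Change of variables with a weight *)

(** Both sides are additive in [f] and compatible with increasing limits, so indicators determine
    everything: pass to simple functions, then use monotone convergence. It serves twice: with [U]
    the identity and [Y] a density, and with [U] one coordinate of [X] and [Y] the product of the
    other factors. *)
Lemma ge0_integral_indic_density d1 d2 (T1 : measurableType d1)
    (T2 : measurableType d2) (R : realType)
    (mu : {measure set T1 -> \bar R}) (nu : {measure set T2 -> \bar R})
    (U : T1 -> T2) (Y : T1 -> R) (c : R) :
  measurable_fun setT U -> measurable_fun setT Y -> (forall x, 0 <= Y x) ->
  0 <= c ->
  (forall B, measurable B ->
    (\int[mu]_x (\1_B (U x) * Y x)%:E = c%:E * nu B)%E) ->
  forall f : T2 -> R, measurable_fun setT f -> (forall y, 0 <= f y) ->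
    (\int[mu]_x (f (U x) * Y x)%:E = c%:E * \int[nu]_y (f y)%:E)%E.
Proof.
move=> mU mY Y0 c0 muE f mf f0.
have simple (h : {nnsfun T2 >-> R}) :
    (\int[mu]_x (h (U x) * Y x)%:E = c%:E * \int[nu]_y (h y)%:E)%E.
  set s := finmap.enum_fset (fset_set (range h)).
  pose A i := h @^-1` [set s`_i].
  have mA i : measurable (A i) by exact: measurable_sfunP.
  have hE y : h y = \sum_(i < size s) s`_i * \1_(A i) y by rewrite fimfunEord.
  have s0 (i : 'I_(size s)) : 0 <= s`_i.
    have : s`_i \in s by exact: mem_nth.
    by rewrite in_fset_set// inE => -[y _ <-].
  under eq_integral do rewrite hE mulr_suml -sumEFin.
  under [in RHS]eq_integral do rewrite hE -sumEFin.
  rewrite !ge0_integral_sum//; last 4 first.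
  - by move=> i; apply/measurable_EFinP/measurable_funM.
  - by move=> i y _; rewrite lee_fin mulr_ge0.
  - move=> i; apply/measurable_EFinP/measurable_funM => //.
    by apply/measurable_funM => //; apply: measurableT_comp.
  - by move=> i y _; rewrite lee_fin !mulr_ge0.
  rewrite ge0_sume_distrr; last first.
    by move=> i _; apply: integral_ge0 => y _; rewrite lee_fin mulr_ge0.
  apply: eq_bigr => i _.
  under eq_integral do rewrite -mulrA EFinM.
  under [in RHS]eq_integral do rewrite EFinM.
  rewrite ge0_integralZl_EFin//; last 2 first.
  - by move=> y _; rewrite lee_fin mulr_ge0.
  - apply/measurable_EFinP/measurable_funM => //.
    exact: measurableT_comp.
  rewrite ge0_integralZl_EFin//; last exact/measurable_EFinP.
  by rewrite muE// integral_indic// setIT muleCA.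
have mfE : measurable_fun setT (EFin \o f) by exact/measurable_EFinP.
pose g := nnsfun_approx measurableT mfE.
have gf y : (g n y)%:E @[n --> \oo] --> (f y)%:E.
  by apply: cvg_nnsfun_approx => // z _; rewrite lee_fin.
have nd y : {homo (fun n => g n y) : n m / (n <= m)%N >-> n <= m}.
  by move=> n m nm; exact/lefP/nd_nnsfun_approx.
(* The two sides are limits along the same simple approximations [g n], on which they agree by
   [simple]; uniqueness of limits concludes. *)
have cvgL : (\int[mu]_x (g n (U x) * Y x)%:E @[n --> \oo] -->
    \int[mu]_x (f (U x) * Y x)%:E)%E.
  rewrite [X in _ --> X](_ : _ =
      (\int[mu]_x limn (fun n => (g n (U x) * Y x)%:E))%E); last first.
    apply: eq_integral => x _; apply/esym/cvg_lim => //.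
    by under eq_fun do rewrite EFinM; rewrite EFinM; apply: cvgeZr.
  apply: cvg_monotone_convergence => //.
  - move=> n; apply/measurable_EFinP/measurable_funM => //.
    exact: measurableT_comp.
  - by move=> n x _; rewrite lee_fin mulr_ge0.
  - by move=> x _ n m nm; rewrite lee_fin ler_wpM2r// nd.
have cvgR : (c%:E * \int[nu]_y (g n y)%:E @[n --> \oo] -->
    c%:E * \int[nu]_y (f y)%:E)%E.
  apply: cvgeZl => //.
  rewrite [X in _ --> X](_ : _ = (\int[nu]_y limn (fun n => (g n y)%:E))%E);
    last by apply: eq_integral => x _; apply/esym/cvg_lim.
  apply: cvg_monotone_convergence => //.
  - by move=> n; apply/measurable_EFinP.
  - by move=> n x _; rewrite lee_fin.
  - by move=> x _ n m nm; rewrite lee_fin nd.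
apply: cvg_unique cvgL _ => //.
by apply: cvg_trans cvgR; apply: near_eq_cvg; near=> n; rewrite (simple (g n)).
Unshelve. all: by end_near.
Qed.

(** * Gaussian moment generating function *)

Lemma normal_distribution_expR d (T : measurableType d) (R : realType)
    (P : probability T R) (Z : {RV P >-> R}) (m s a : R) :
  s != 0 ->
  (forall A : set R, measurable A -> distribution P Z A = normal_prob m s A) ->
  (\int[P]_w (expR (a * (Z w - m)))%:E = (expR (a ^+ 2 * s ^+ 2 / 2))%:E)%E.
Proof.
move=> s0 PZ.
have mexp : measurable_fun setT (fun x : R => expR (a * (x - m))).
  apply: measurableT_comp => //; apply: measurable_funM => //.
  exact: measurable_funB.
have pdfE (B : set R) : measurable B ->
    (\int[lebesgue_measure]_x (\1_B x * normal_pdf m s x)%:E =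
     1%:E * distribution P Z B)%E.
  move=> mB; rewrite mul1e PZ// /normal_prob [RHS]integral_mkcond.
  apply: eq_integral => x _; rewrite patchE indicE.
  by case: ifPn => _; rewrite ?mul1r ?mul0r.
transitivity (\int[distribution P Z]_x (expR (a * (x - m)))%:E)%E.
  by rewrite ge0_integral_distribution//; exact/measurable_EFinP.
(* Instance with [U] the identity, [Y] the normal density and [c] equal to 1: the integral against
   the law of [Z] becomes a Lebesgue integral. *)
have := ge0_integral_indic_density (mu := @lebesgue_measure R)
  (nu := distribution P Z) (@measurable_id _ _ setT)
  (measurable_normal_pdf m s) (normal_pdf_ge0 m s) ler01 pdfE mexp
  (fun x => expR_ge0 _).
rewrite mul1e => <-.
(* Completing the square: tilting by [expR (a * (x - m))] shifts the mean by
   [a * s ^+ 2]. *)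
transitivity (\int[lebesgue_measure]_x ((expR (a ^+ 2 * s ^+ 2 / 2))%:E *
    (normal_pdf (m + a * s ^+ 2) s x)%:E))%E.
  apply: eq_integral => x _; rewrite -EFinM !normal_pdfE//; congr EFin.
  rewrite mulrCA [RHS]mulrCA; congr *%R.
  by rewrite /normal_fun -!expRD; congr expR; field.
rewrite ge0_integralZl_EFin ?expR_ge0//; last 2 first.
- by move=> x _; rewrite lee_fin normal_pdf_ge0.
- by apply/measurable_EFinP; exact: measurable_normal_pdf.
by rewrite integral_normal_pdf mule1.
Qed.

(** * Expectation of a product of independent factors *)

Lemma mutually_independent_expectation_prod d (T : measurableType d)
    (R : realType) (P : probability T R) (n : nat) (X : 'I_n -> {RV P >-> R})
    (f : 'I_n -> R -> R) (c : 'I_n -> R) :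
  mutually_independent X ->
  (forall i, measurable_fun setT (f i)) -> (forall i x, 0 <= f i x) ->
  (forall i, \int[P]_w (f i (X i w))%:E = (c i)%:E)%E ->
  (\int[P]_w (\prod_(i < n) f i (X i w))%:E = (\prod_(i < n) c i)%:E)%E.
Proof.
move=> indX.
(* Functions are traded for indicators one coordinate at a time: only those of
   index at least k are required to be indicators. *)
suff H k : (k <= n)%N -> forall (f : 'I_n -> R -> R) (c : 'I_n -> R),
    (forall i, measurable_fun setT (f i)) -> (forall i x, 0 <= f i x) ->
    (forall i, \int[P]_w (f i (X i w))%:E = (c i)%:E)%E ->
    (forall i : 'I_n, (k <= i)%N -> exists2 B, measurable B & f i = \1_B) ->
    (\int[P]_w (\prod_(i < n) f i (X i w))%:E = (\prod_(i < n) c i)%:E)%E.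
  move=> mf f0 fc; apply: (H n) => // i.
  by rewrite leqNgt ltn_ord.
have mX i B : measurable B -> measurable (X i @^-1` B).
  by move=> mB; rewrite -[X in measurable X]setTI; exact: measurable_funP.
have iX i B : measurable B ->
    (\int[P]_w (\1_B (X i w))%:E = P (X i @^-1` B))%E.
  by move=> mB; rewrite -[X i @^-1` B]setIT -integral_indic//; exact: mX.
elim: k => [_|k IH kn] {}f {}c mf f0 fc find.
  have /choice[B HB] i : exists B, measurable B /\ f i = \1_B.
    by have [//|B mB fB] := find i; exists B.
  have mB i := (HB i).1; have fB i := (HB i).2.
  have cB i : (c i)%:E = P (X i @^-1` B i).
    by rewrite -fc fB iX.
  (* With indicators only, the product is the indicator of an intersection, and the claim is the
     definition of independence. *)
  have -> : (fun w => (\prod_(i < n) f i (X i w))%:E) =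
      EFin \o \1_(\bigcap_(i in [set: 'I_n]) (X i @^-1` B i)).
    apply/funext => w /=; congr EFin; rewrite indicE.
    have [wB|/negP wB] := boolP (w \in _).
      rewrite big1// => i _; rewrite fB indicE mem_set//.
      by move: wB; rewrite inE => /(_ i); exact.
    have [i wi] : exists i, ~ B i (X i w).
      apply/existsNP => wB'; apply: wB; rewrite inE => i _; exact: wB'.
    by rewrite (bigD1 i)//= fB indicE memNset// mul0r.
  rewrite integral_indic//; last first.
    by apply: fin_bigcap_measurable => // i _; exact: mX.
  rewrite setIT -prodEFin; apply: etrans (indX B mB) _.
  by apply: eq_bigr => i _; rewrite cB.
pose i0 := Ordinal kn.
pose Y w := \prod_(i < n | i != i0) f i (X i w).
pose e := \prod_(i < n | i != i0) c i.
have c0 i : 0 <= c i.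
  by rewrite -lee_fin -fc; apply: integral_ge0 => w _; rewrite lee_fin.
have mY : measurable_fun setT Y.
  rewrite /Y; under eq_fun do rewrite big_mkcond.
  apply: measurable_prod => i _; case: (i != i0) => //.
  exact: measurableT_comp.
have Y0 w : 0 <= Y w by apply: prodr_ge0.
have e0 : 0 <= e by apply: prodr_ge0.
(* Replacing factor [i0], whose index is [k], by [\1_B] makes every factor from index [k] on an
   indicator, so [IH] applies. This holds for all [B], which is the premise needed to return from
   [\1_B] to [f i0]. *)
have YB B : measurable B ->
    (\int[P]_w (\1_B (X i0 w) * Y w)%:E = e%:E * distribution P (X i0) B)%E.
  move=> mB.
  pose f' i : R -> R := if i == i0 then \1_B else f i.
  pose c' i := if i == i0 then fine (P (X i0 @^-1` B)) else c i.
  have f'0 : f' i0 = \1_B by rewrite /f' eqxx.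
  have c'0 : c' i0 = fine (P (X i0 @^-1` B)) by rewrite /c' eqxx.
  have f'N i : i != i0 -> f' i = f i by rewrite /f' => /negbTE ->.
  have c'N i : i != i0 -> c' i = c i by rewrite /c' => /negbTE ->.
  have c'E : \prod_(i < n) c' i = e * fine (P (X i0 @^-1` B)).
    by rewrite (bigD1 i0)// c'0 (eq_bigr _ c'N); exact: mulrC.
  have /(_ f' c') := IH (ltnW kn).
  rewrite c'E EFinM fineK ?fin_num_measure//; last exact: mX.
  move=> <-.
  - apply: eq_integral => w _; rewrite (bigD1 i0)// f'0.
    by congr (_ * _)%:E; apply: eq_bigr => i ii0; rewrite f'N.
  - by move=> i; rewrite /f'; case: ifP.
  - by move=> i x; rewrite /f'; case: ifP.
  - move=> i; rewrite /f' /c'; case: eqP => [->|_]; last exact: fc.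
    rewrite fineK ?fin_num_measure//; last exact: mX.
    exact: iX.
  - move=> i ki; rewrite /f'; case: eqP => [_|/eqP ii0]; first by exists B.
    apply: find; rewrite ltn_neqAle ki andbT.
    by apply: contra_neqN ii0 => /eqP ki'; exact/val_inj.
rewrite (bigD1 i0)//= -/e mulrC EFinM -fc.
under eq_integral do rewrite (bigD1 i0)//= -/(Y _).
rewrite (ge0_integral_indic_density (nu := distribution P (X i0)) _ mY Y0 e0 YB)//.
congr *%E; rewrite ge0_integral_distribution//.
- exact/measurable_EFinP.
- by move=> y; rewrite lee_fin.
Qed.

(** * Moments of the Gaussian vector *)

Section gaussian_vector.
Context d (T : measurableType d) (R : realType) (P : probability T R) (n : nat).
Variables (X : 'I_n -> {RV P >-> R}) (t0 : 'rV[R]_n) (s : R).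
Hypotheses (s0 : s != 0) (gX : is_gaussian_vector X t0 s).

Lemma gaussian_vector_expR i (a : R) :
  (\int[P]_w (expR (a * (X i w - t0 ord0 i)))%:E =
   (expR (a ^+ 2 * s ^+ 2 / 2))%:E)%E.
Proof. by apply: normal_distribution_expR => //; exact: gX.2. Qed.

(** The exponential of a sum is a product of functions of single coordinates, so independence
    applies. The constant term is spread over the coordinates to keep one sum in the exponent. *)
Lemma gaussian_vector_expR_dot (a : 'I_n -> R) (b : 'I_n -> R) :
  (\int[P]_w (expR (\sum_(i < n) (a i * (X i w - t0 ord0 i) + b i)))%:E =
   (expR (\sum_(i < n) (a i ^+ 2 * s ^+ 2 / 2 + b i)))%:E)%E.
Proof.
under eq_integral do rewrite expR_sum.
rewrite expR_sum.
apply: (@mutually_independent_expectation_prod _ _ _ _ _ X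
  (fun i x => expR (a i * (x - t0 ord0 i) + b i))).
- exact: gX.1.
- move=> i; apply: measurableT_comp => //; apply: measurable_funD => //.
  by apply: measurable_funM => //; exact: measurable_funB.
- by move=> i x; exact: expR_ge0.
move=> i.
under eq_integral do rewrite expRD mulrC EFinM.
rewrite ge0_integralZl_EFin ?expR_ge0//.
- by rewrite gaussian_vector_expR -EFinM -expRD addrC.
- apply/measurable_EFinP; apply: measurableT_comp => //.
  by apply: measurable_funM => //; exact: measurable_funB.
Qed.

(** For [x >= 0], squaring [1 + x / 2 <= expR (x / 2)] already gives [x ^+ 2 / 4 <= expR x]; the
    second exponential makes the bound even. Finite second moments then follow from the moment
    generating function at 1 and -1. *)
Lemma sqr_le_expR (x : R) : x ^+ 2 <= 4 * (expR x + expR (- x)).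
Proof.
wlog x0 : x / 0 <= x.
  move=> H; have [/H//|/ltW] := leP 0 x.
  by rewrite -oppr_ge0 => /H; rewrite sqrrN opprK addrC.
have h : (1 + x / 2) ^+ 2 <= expR x.
  have -> : expR x = expR (x / 2) ^+ 2 by rewrite -expRM_natl; congr expR; field.
  by rewrite ler_pXn2r ?nnegrE ?expR_ge0 ?expR_ge1Dx//; lra.
have := expR_ge0 (- x); nra.
Qed.

Lemma gaussian_vector_sqr_lty :
  (\int[P]_w (\sum_(i < n) (X i w - t0 ord0 i) ^+ 2)%:E < +oo)%E.
Proof.
under eq_integral do rewrite -sumEFin.
rewrite ge0_integral_sum//; last 2 first.
- move=> i; apply/measurable_EFinP/measurable_funX; exact: measurable_funB.
- by move=> i w _; rewrite lee_fin sqr_ge0.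
apply: lte_sum_pinfty => i _.
have mE (a : R) :
    measurable_fun setT (fun w => (expR (a * (X i w - t0 ord0 i)))%:E).
  apply/measurable_EFinP; apply: measurableT_comp => //.
  by apply: measurable_funM => //; exact: measurable_funB.
apply: (@le_lt_trans _ _ (\int[P]_w (4%:E *
    ((expR (1 * (X i w - t0 ord0 i)))%:E +
     (expR (-1 * (X i w - t0 ord0 i)))%:E)))%E).
  apply: ge0_le_integral => //.
  - by move=> w _; rewrite lee_fin sqr_ge0.
  - apply/measurable_EFinP/measurable_funX; exact: measurable_funB.
  - by apply: measurable_funeM; apply: emeasurable_funD.
  - by move=> w _; rewrite -EFinD -EFinM lee_fin mul1r mulN1r; exact: sqr_le_expR.
rewrite ge0_integralZl_EFin//; last 2 first.
- by move=> w _; rewrite -EFinD lee_fin addr_ge0// expR_ge0.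
- exact: emeasurable_funD.
by rewrite ge0_integralD// !gaussian_vector_expR -EFinD -EFinM ltry.
Qed.

End gaussian_vector.

(** * Distance between orbits *)

Section lin_iso_action.
Context (R : realType) (n : nat) (gT : finGroupType).
Variable act : gT -> 'rV[R]_n -> 'rV[R]_n.
Hypothesis actP : lin_iso_action act.

Lemma enorm_ge0 (x : 'rV[R]_n) : 0 <= enorm x.
Proof. exact: sqrtr_ge0. Qed.

Lemma sqr_enorm (x : 'rV[R]_n) : enorm x ^+ 2 = \sum_(i < n) x ord0 i ^+ 2.
Proof. by rewrite sqr_sqrtr// sumr_ge0// => i _; exact: sqr_ge0. Qed.

(** Apply the isometry [act g] to [a - act g^-1 b]. This frees the random argument from the action,
    so squared distances become explicit quadratic polynomials in its coordinates. *)
Lemma enorm_act_sub g a b : enorm (act g a - b) = enorm (a - act g^-1%g b).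
Proof.
have [act1 actM actL actN] := actP.
rewrite -(actN g (a - _)) [in RHS]addrC -[in RHS]scaleN1r actL -actM mulgV.
by rewrite act1 scaleN1r addrC.
Qed.

Lemma orbit_dist_le g a b : orbit_dist act a b <= enorm (act g a - b).
Proof. exact: ge_bigmin_seq. Qed.

Lemma orbit_dist_le1 a b : orbit_dist act a b <= enorm (a - b).
Proof. by have [act1 _ _ _] := actP; rewrite -{2}[a]act1 orbit_dist_le. Qed.

Lemma orbit_dist_attained a b :
  exists g, orbit_dist act a b = enorm (act g a - b).
Proof.
rewrite /orbit_dist; elim/big_ind: _ => [|x y [g ->] [h ->]|g _].
- by exists 1%g.
- by rewrite /Order.min; case: ifP => _; [exists g|exists h].
- by exists g.
Qed.

Lemma orbit_dist_ge0 a b : 0 <= orbit_dist act a b.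
Proof. by have [g ->] := orbit_dist_attained a b; exact: enorm_ge0. Qed.

Lemma measurable_sqr_orbit_dist d (T : measurableType d) (Z : T -> 'rV[R]_n)
    (b : 'rV[R]_n) :
  (forall i, measurable_fun setT (fun w => Z w ord0 i)) ->
  measurable_fun setT (fun w => orbit_dist act (Z w) b ^+ 2).
Proof.
move=> mZ; apply: measurable_funX.
have mE g : measurable_fun setT (fun w => enorm (act g (Z w) - b)).
  under eq_fun do rewrite enorm_act_sub.
  apply: measurableT_comp => //.
    by apply: continuous_measurable_fun; exact: sqrt_continuous.
  apply: measurable_sum => i; apply: measurable_funX.
  under eq_fun do rewrite !mxE.
  exact: measurable_funB.
rewrite /orbit_dist; elim: (index_enum gT) => [|g s IH].
  by under eq_fun do rewrite big_nil; exact: mE.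
under eq_fun do rewrite big_cons.
exact: measurable_minr.
Qed.

End lin_iso_action.

(** * Comparing the minimiser with the template *)

Section template_estimation.
Context (R : realType) (n : nat) (gT : finGroupType).
Context d (T : measurableType d) (P : probability T R).
Variables (act : gT -> 'rV[R]_n -> 'rV[R]_n) (X : 'I_n -> {RV P >-> R}).
Variables (t0 : 'rV[R]_n) (s : R) (m : 'rV[R]_n).
Hypotheses (actP : lin_iso_action act) (s_gt0 : 0 < s).
Hypothesis gX : is_gaussian_vector X t0 s.

Let S w := enorm (rvec X w - t0) ^+ 2.

Let measurable_rvec i : measurable_fun setT (fun w => rvec X w ord0 i).
Proof. by under eq_fun do rewrite mxE; exact: measurable_funP. Qed.

Let SE w : S w = \sum_(i < n) (X i w - t0 ord0 i) ^+ 2.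
Proof. by rewrite /S sqr_enorm; apply: eq_bigr => i _; rewrite !mxE. Qed.

Let measurable_S : measurable_fun setT S.
Proof.
rewrite (funext SE).
by apply: measurable_sum => i; apply: measurable_funX; exact: measurable_funB.
Qed.

Lemma Frechet_F_mean_le : (Frechet_F act X t0 <= \int[P]_w (S w)%:E)%E.
Proof.
rewrite /Frechet_F unlock; apply: ge0_le_integral => //.
- by move=> w _; rewrite lee_fin sqr_ge0.
- by apply/measurable_EFinP; exact: measurable_sqr_orbit_dist.
- exact/measurable_EFinP.
- move=> w _; rewrite lee_fin ler_pXn2r ?nnegrE ?enorm_ge0 ?orbit_dist_ge0//.
  exact: orbit_dist_le1.
Qed.

(** The quadratic terms cancel: with [a = t0 - b], the difference of squares is
    [-2 <X - t0, a> - |a|^2]. The linear part contributes [|a|^2 / (8 s^2)] through the moment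
    generating function, against the constant [- |a|^2 / (4 s^2)]. *)
Lemma expectation_expR_sqr_enorm_sub (b : 'rV[R]_n) :
  (\int[P]_w (expR ((S w - enorm (rvec X w - b) ^+ 2) / (4 * s ^+ 2)))%:E =
   (expR (- enorm (t0 - b) ^+ 2 / (8 * s ^+ 2)))%:E)%E.
Proof.
have sn0 : s != 0 by rewrite gt_eqF.
pose a i := t0 ord0 i - b ord0 i.
have := gaussian_vector_expR_dot sn0 gX (fun i => - a i / (2 * s ^+ 2))
  (fun i => - a i ^+ 2 / (4 * s ^+ 2)).
have -> : \sum_(i < n) ((- a i / (2 * s ^+ 2)) ^+ 2 * s ^+ 2 / 2 +
      - a i ^+ 2 / (4 * s ^+ 2)) = - enorm (t0 - b) ^+ 2 / (8 * s ^+ 2).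
  rewrite sqr_enorm mulNr mulr_suml -sumrN; apply: eq_bigr => i _.
  by rewrite !mxE -/(a i); field.
move=> <-; apply: eq_integral => w _; congr (expR _)%:E.
rewrite SE sqr_enorm -sumrB mulr_suml; apply: eq_bigr => i _.
by rewrite !mxE /a; field.
Qed.

(* This is [1 + x <= expR x] at the element of the orbit closest to [X w]. *)
Lemma orbit_dist_expR_le w :
  1 + (4 * s ^+ 2)^-1 * S w <=
  (4 * s ^+ 2)^-1 * orbit_dist act (rvec X w) m ^+ 2 +
  \sum_g expR ((S w - enorm (rvec X w - act g^-1%g m) ^+ 2) / (4 * s ^+ 2)).
Proof.
have [g ->] := orbit_dist_attained act (rvec X w) m.
rewrite (enorm_act_sub actP) (bigD1 g)//=.
set x := (S w - _) / _; set y := \sum_(i | _) _.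
have y0 : 0 <= y by apply: sumr_ge0 => h _; exact: expR_ge0.
have := expR_ge1Dx x; rewrite {1}/x; lra.
Qed.

Hypothesis mP : (Frechet_F act X m <= Frechet_F act X t0)%E.

Lemma sum_expR_ge1 :
  1 <= \sum_g expR (- enorm (t0 - act g^-1%g m) ^+ 2 / (8 * s ^+ 2)).
Proof.
set b := (4 * s ^+ 2)^-1.
have b0 : 0 <= b by rewrite invr_ge0 mulr_ge0// sqr_ge0.
pose D w := orbit_dist act (rvec X w) m ^+ 2.
pose E g w := expR ((S w - enorm (rvec X w - act g^-1%g m) ^+ 2) / (4 * s ^+ 2)).
have mD : measurable_fun setT D by exact: measurable_sqr_orbit_dist.
have mE g : measurable_fun setT (E g).
  apply: measurableT_comp => //; apply: measurable_funM => //.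
  apply: measurable_funB => //; under eq_fun do rewrite sqr_enorm.
  apply: measurable_sum => i; apply: measurable_funX.
  by under eq_fun do rewrite !mxE; exact: measurable_funB.
have mSE : measurable_fun setT (fun w => (S w)%:E) by exact/measurable_EFinP.
have mDE : measurable_fun setT (fun w => (D w)%:E) by exact/measurable_EFinP.
have mEE g : measurable_fun setT (fun w => (E g w)%:E).
  exact/measurable_EFinP.
have S0 w : setT w -> (0 <= (S w)%:E)%E by rewrite lee_fin sqr_ge0.
have D0 w : setT w -> (0 <= (D w)%:E)%E by rewrite lee_fin sqr_ge0.
have E0 g w : setT w -> (0 <= (E g w)%:E)%E by rewrite lee_fin expR_ge0.
have bS0 w : setT w -> (0 <= b%:E * (S w)%:E)%E by move=> ?; rewrite mule_ge0 ?S0.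
have bD0 w : setT w -> (0 <= b%:E * (D w)%:E)%E by move=> ?; rewrite mule_ge0 ?D0.
have EE0 w : setT w -> (0 <= \sum_g (E g w)%:E)%E.
  by move=> ?; apply: sume_ge0 => g _; exact: E0.
have mbS := measurable_funeM b%:E mSE.
have mbD := measurable_funeM b%:E mDE.
have mEs : measurable_fun setT (fun w => \sum_g (E g w)%:E)%E.
  exact: emeasurable_sum.
(* Finiteness is what permits cancelling [b * E S] in the extended reals at the end. *)
have Sfin : (\int[P]_w (S w)%:E)%E \is a fin_num.
  rewrite ge0_fin_numE; last exact: integral_ge0.
  under eq_integral do rewrite SE.
  by apply: gaussian_vector_sqr_lty gX; rewrite gt_eqF.
have DS : (\int[P]_w (D w)%:E <= \int[P]_w (S w)%:E)%E.
  apply: le_trans Frechet_F_mean_le; apply: le_trans mP.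
  by rewrite /Frechet_F unlock.
have P1 : (\int[P]_w 1%:E = 1)%E.
  by rewrite (integral_cst P measurableT) mul1e; exact: probability_setT.
have : (\int[P]_w (1 + b%:E * (S w)%:E) <=
    \int[P]_w (b%:E * (D w)%:E + \sum_g (E g w)%:E))%E.
  apply: ge0_le_integral => //.
  - by move=> w ?; rewrite adde_ge0 ?bS0.
  - exact: emeasurable_funD.
  - exact: emeasurable_funD.
  - move=> w _; rewrite sumEFin -!EFinM -!EFinD lee_fin.
    exact: orbit_dist_expR_le.
rewrite !ge0_integralD//.
rewrite P1.
rewrite !ge0_integralZl_EFin//.
rewrite ge0_integral_sum//.
under eq_bigr do rewrite expectation_expR_sqr_enorm_sub.
rewrite sumEFin => H.
(* Add [b * E S] to both sides; then [H] and [E D <= E S] give the claim. *)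
rewrite -lee_fin -(leeD2lE (x := b%:E * \int[P]_w (S w)%:E)) ?fin_numM// addeC.
apply: le_trans H _.
by apply: leeD2r; apply: lee_wpmul2l => //; rewrite lee_fin.
Qed.

Lemma sqr_dQ_le : dQ act t0 m ^+ 2 <= 8 * s ^+ 2 * ln #|gT|%:R.
Proof.
have K0 : 0 < 8 * s ^+ 2 by rewrite mulr_gt0// exprn_gt0.
have G0 : 0 < #|gT|%:R :> R by rewrite ltr0n; apply/card_gt0P; exists 1%g.
have le1 : 1 <= #|gT|%:R * expR (- dQ act t0 m ^+ 2 / (8 * s ^+ 2)).
  apply: le_trans sum_expR_ge1 _.
  set e := expR _; have -> : #|gT|%:R * e = \sum_(g : gT) e.
    by rewrite sumr_const mulr_natl.
  (* Each [|t0 - g^-1.m|] equals [|g.t0 - m|], hence is at least the minimum [dQ act t0 m]. *)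
  apply: ler_sum => g _.
  rewrite ler_expR ler_pM2r ?invr_gt0// lerN2.
  rewrite ler_pXn2r ?nnegrE ?enorm_ge0 ?orbit_dist_ge0//.
  by rewrite -(enorm_act_sub actP) orbit_dist_le.
have : ln 1 <= ln (#|gT|%:R * expR (- dQ act t0 m ^+ 2 / (8 * s ^+ 2))).
  by rewrite ler_ln ?posrE// mulr_gt0// expR_gt0.
rewrite ln1 lnM ?posrE ?expR_gt0// expRK mulNr subr_ge0 ler_pdivrMr//.
by rewrite mulrC.
Qed.

End template_estimation.

Theorem mainTheorem6 (R : realType) (n : nat) (gT : finGroupType)
  (act : gT -> 'rV[R]_n -> 'rV[R]_n)
  (d : measure_display) (T : measurableType d) (P : probability T R)
  (X : 'I_n -> {RV P >-> R}) (t0 : 'rV[R]_n) (s : R) (mstar : 'rV[R]_n) :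
  lin_iso_action act ->
  0 < s ->
  is_gaussian_vector X t0 s ->
  (forall m : 'rV[R]_n, (Frechet_F act X mstar <= Frechet_F act X m)%E) ->
  dQ act t0 mstar <= s * Num.sqrt (8 * ln (#|gT|%:R)).
Proof.
move=> actP s0 gX mP.
have := sqr_dQ_le actP s0 gX (mP t0).
rewrite -mulrA mulrCA => dle.
(* Write [s] as the root of its square, so that the right side is a single root and the squared
   bound passes under it by monotonicity. *)
rewrite -[s](ger0_norm (ltW s0)) -sqrtr_sqr -sqrtrM ?sqr_ge0//.
apply: le_trans (ler_wsqrtr dle).
by rewrite sqrtr_sqr ler_norm.
Qed.
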